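(* Let $N,M\ge1$ and consider the discrete circle model with $N$ drivers and $M$ locations described in the context, with arbitrary (not necessarily uniform) user law $Q$ and driver law $P$ on $X$ such that $Q(\{x\})>0$ and $P(\{x\})>0$ for all $x\in X$. Then any optimal policy $\rho$ always assigns the user to one of its two neighbours: for every driver configuration $s$ and every user position $u$, the driver assigned by $\rho$ in state $(s,u)$ is located at $R(u,s)$ or at $L(u,s)$. As a consequence, at least half of the actions of any optimal policy are greedy, i.e. for at least half of all states $(s,u)$ the driver assigned by $\rho$ is at minimum distance from $u$ among all drivers in $s$.
   Context: Discrete circle model: $X=\{m/M: m=1,\dots,M\}$, viewed as $M$ equally spaced points on the circle of length 1 ($0$ and $1$ identified), with distance $d(u,v)=\min(|v-u|,1-|v-u|)$. A driver configuration is a sorted tuple $s=(s_1\le\dots\le s_N)$ of elements of $X$ (several drivers may share a location). Users' positions $(x_t)_{t\ge1}$ are i.i.d. with law $Q$ on $X$, new drivers' positions $(y_t)_{t\ge1}$ are i.i.d. with law $P$ on $X$, and the two sequences are independent. At each stage $t$, with current drivers $s^t$, a user appears at $u=x_t$; a policy selects one driver, located at $s^t_k$ say; the cost $c_t=d(x_t,s^t_k)$ is incurred; this driver is removed and a new driver is added at $y_t$, and the positions are re-sorted to give $s^{t+1}$. A policy is a function $\rho$ that takes as input a state $(s,u)$ (a driver configuration $s$ and a user position $u\in X$) and returns the driver (index in $\{1,\dots,N\}$) assigned to the user. Its long-run average cost from an initial configuration is $\lim_{T\to\infty}\frac1T\sum_{t=1}^T\mathbb{E}[c_t]$. A policy is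 optimal if it minimises this long-run average cost among all policies, for every initial configuration. Neighbours: $R(u,s)$ is the first driver encountered when moving from $u$ to the right (increasing direction on the circle), and $L(u,s)$ is the first driver encountered when moving to the left; if there is a driver exactly at $u$, then $R(u,s)=L(u,s)=u$. *)

(* Defs.v *)
From mathcomp Require Import all_boot all_order all_algebra.
From mathcomp Require Import all_classical all_reals all_analysis.

Set Implicit Arguments.
Unset Strict Implicit.
Unset Printing Implicit Defensive.

Import Order.TTheory GRing.Theory Num.Theory.

Local Open Scope ring_scope.

(* The ordinal i : 'I_M stands for the location (i+1)/M of X = {1/M, .., M/M};
   the last one, 1, is the same point of the circle as 0. *)
Definition pos (R : realType) (M : nat) (i : 'I_M) : R := i.+1%:R / M%:R.

Definition dist (R : realType) (M : nat) (u v : 'I_M) : R :=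
  Num.min `|pos R v - pos R u| (1 - `|pos R v - pos R u|).

Definition loc_le (M : nat) : rel 'I_M := fun a b => (a <= b)%N.

Definition config (N M : nat) : Type :=
  {s : N.-tuple 'I_M | sorted (@loc_le M) s}.

Definition driver (N M : nat) (s : config N M) (k : 'I_N) : 'I_M :=
  tnth (val s) k.

Lemma loc_le_total (M : nat) : total (@loc_le M).
Proof. by move=> a b; exact: leq_total. Qed.

(* Removing driver k and adding a driver at y amounts, up to the final sort,
   to overwriting the k-th entry by y. *)
Definition step (N M : nat) (s : config N M) (k : 'I_N) (y : 'I_M) :
    config N M :=
  exist _ [tuple of sort (@loc_le M)
             [tuple if i == k then y else driver s i | i < N]]
    (sort_sorted (@loc_le_total M) _).

Definition policy (N M : nat) : Type := config N M -> 'I_M -> 'I_N.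

(* Stages are numbered from 0: us t and ds t are the positions of the user and
   of the new driver of stage t. *)
Fixpoint drivers_at (N M : nat) (rho : policy N M) (s0 : config N M)
    (us ds : nat -> 'I_M) (t : nat) : config N M :=
  if t is t'.+1 then
    let s := drivers_at rho s0 us ds t' in step s (rho s (us t')) (ds t')
  else s0.

Definition stage_cost (R : realType) (N M : nat) (rho : policy N M)
    (s0 : config N M) (us ds : nat -> 'I_M) (t : nat) : R :=
  let s := drivers_at rho s0 us ds t in
  dist R (us t) (driver s (rho s (us t))).

Definition full_support_law (R : realType) (M : nat) (Q : 'I_M -> R) : Prop :=
  (forall a, 0 < Q a) /\ \sum_a Q a = 1.

Local Open Scope classical_set_scope.

Definition has_law (d : measure_display) (Omega : measurableType d)
    (R : realType) (Pr : probability Omega R) (M : nat)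
    (z : Omega -> 'I_M) (Q : 'I_M -> R) : Prop :=
  forall a, measurable (z @^-1` [set a]) /\ Pr (z @^-1` [set a]) = (Q a)%:E.

Definition mutually_independent (d : measure_display)
    (Omega : measurableType d) (R : realType) (Pr : probability Omega R)
    (M : nat) (I : eqType) (z : I -> Omega -> 'I_M) : Prop :=
  forall (J : seq I) (A : I -> set 'I_M), uniq J ->
    Pr (\bigcap_(i in [set` J]) z i @^-1` A i) =
    (\prod_(i <- J) Pr (z i @^-1` A i))%E.

(* "x i.i.d. of law Q, y i.i.d. of law P, x and y independent": mutual
   independence is that of the joint family (x_t)_t, (y_t)_t. *)
Definition arrivals (d : measure_display) (Omega : measurableType d)
    (R : realType) (Pr : probability Omega R) (M : nat)
    (Q P : 'I_M -> R) (x y : nat -> Omega -> 'I_M) : Prop :=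
  [/\ forall t, has_law Pr (x t) Q,
      forall t, has_law Pr (y t) P &
      mutually_independent Pr
        (fun i : nat + nat => match i with inl t => x t | inr t => y t end)].

(* The limit always exists: the state is a finite Markov chain under any
   policy. *)
Definition average_cost (d : measure_display) (Omega : measurableType d)
    (R : realType) (Pr : probability Omega R) (N M : nat)
    (x y : nat -> Omega -> 'I_M) (rho : policy N M) (s0 : config N M) : \bar R :=
  limn (fun T : nat =>
    ((T%:R^-1)%:E * \sum_(t < T)
       'E_Pr[(fun w => stage_cost R rho s0 (x^~ w) (y^~ w) t)])%E).

Definition optimal (d : measure_display) (Omega : measurableType d)
    (R : realType) (Pr : probability Omega R) (N M : nat)
    (x y : nat -> Omega -> 'I_M) (rho : policy N M) : Prop :=
  forall (rho' : policy N M) (s0 : config N M),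
    (average_cost Pr x y rho s0 <= average_cost Pr x y rho' s0)%E.

Local Close Scope classical_set_scope.

(* Walk around the circle from u (u included), to the right through ordS and to
   the left through ord_pred, and stop at the first driver met.  The default u
   of head is reached only if there is no driver at all. *)
Definition right_neighbour (N M : nat) (u : 'I_M) (s : config N M) : 'I_M :=
  head u [seq v <- traject (@ordS M) u M | v \in val s].

Definition left_neighbour (N M : nat) (u : 'I_M) (s : config N M) : 'I_M :=
  head u [seq v <- traject (@ord_pred M) u M | v \in val s].

Definition greedy_at (R : realType) (N M : nat) (rho : policy N M)
    (s : config N M) (u : 'I_M) : bool :=
  [forall k : 'I_N,
     dist R u (driver s (rho s u)) <= dist R u (driver s k)].

(* Main.v *)
(** Value iteration with discount b, started at 0, gives functions of the driver
configuration that are 1-Lipschitz for moving one driver, because a configuration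
with a driver moved from c to a can imitate the other one at extra cost at most
d(a,c), until the moved driver is used.  Hence matching a user to a driver at the
same place is optimal; and since exact matchings can bring all the other drivers
to c, after which a user at a makes the imitation strictly profitable, the
Lipschitz bound is strict by a margin independent of b.  So serving a user
by a driver lying beyond a neighbour is worse, by such a margin, than serving it
by that neighbour.

As b tends to 1, the discounted values, which have span at most N, almost solve
the average cost optimality equation, so an optimal policy cannot visit states in
which it loses such a margin with positive frequency.  If there were a
configuration with a bad choice, then outside bad configurations the policy
matches exactly, so exact matchings would lead from anywhere to a bad
configuration.

For the last claim, reflect the user in the gap between its two neighbours.  If
the policy were not greedy at both positions, exchanging its two choices would
keep the two resulting configurations and lower the sum of the two costs. *)

From HB Require Import structures.
Require Import Defs.
From mathcomp Require Import all_boot all_order all_algebra.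
From mathcomp Require Import all_classical all_reals all_analysis.
From mathcomp Require Import measurable_realfun perm zify ring lra.

Set Implicit Arguments.
Unset Strict Implicit.
Unset Printing Implicit Defensive.

Import Order.TTheory GRing.Theory Num.Theory.
Import numFieldNormedType.Exports.

Local Open Scope ring_scope.

(** * Geometry of the circle *)

Section Circle.
Variable M : nat.
Implicit Types (a b c u v : 'I_M) (s : seq 'I_M).

(** Counted in steps of length 1/M to the right from [u] to [v]; integer lengths reduce the circle
    geometry to linear arithmetic. *)
Definition arc_length u v : nat := (if u <= v then v - u else v + M - u)%N.

Lemma arc_lengthxx u : arc_length u u = 0%N.
Proof. by rewrite /arc_length leqnn subnn. Qed.

Lemma arc_length_lt u v : (arc_length u v < M)%N.
Proof.
have := ltn_ord u; have := ltn_ord v.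
by rewrite /arc_length; case: ifP; lia.
Qed.

Lemma arc_lengthC u v : u != v -> (arc_length u v + arc_length v u = M)%N.
Proof.
have := ltn_ord u; have := ltn_ord v.
by rewrite -val_eqE /= /arc_length; do !case: ifP; lia.
Qed.

Definition ndist u v : nat := minn (arc_length u v) (arc_length v u).

Lemma distE (R : realType) u v : dist R u v = (ndist u v)%:R / M%:R.
Proof.
have M_gt0 : (0 < M)%N by apply: leq_ltn_trans (ltn_ord u).
have MR : (M%:R : R) != 0 by rewrite pnatr_eq0 -lt0n.
have -> : dist R u v =
    Num.min `|(v : nat)%:R - (u : nat)%:R| (M%:R - `|(v : nat)%:R - (u : nat)%:R|) / M%:R.
  have -> : dist R u v = Num.min (`|(v : nat)%:R - (u : nat)%:R| / M%:R)
      ((M%:R - `|(v : nat)%:R - (u : nat)%:R|) / M%:R).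
    rewrite /dist /pos -mulrBl normrM normfV normr_nat mulrBl divff //.
    by rewrite -!natr1 opprD addrACA subrr addr0.
  by rewrite -minr_pMl // invr_ge0.
congr (_ / _); rewrite /ndist /arc_length.
have lu := ltn_ord u; have lv := ltn_ord v.
wlog uv : u v lu lv / (u <= v)%N => [W|].
  case/orP: (leq_total u v) => [uv|vu]; first exact: W.
  by rewrite distrC (W v u lv lu vu) minnC.
rewrite -natrB // normr_nat -natrB; last by lia.
rewrite uv -minEnat; case: ifP => vu; last first.
  by rewrite -natr_min; congr (_ %:R); rewrite minEnat; lia.
have /val_inj <- : val u = val v by apply/eqP; rewrite eqn_leq uv.
by rewrite subnn subn0 -natr_min; congr (_%:R); rewrite minEnat; lia.
Qed.

Lemma ndistC u v : ndist u v = ndist v u.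
Proof. exact: minnC. Qed.

Lemma ndistxx u : ndist u u = 0%N.
Proof. by rewrite /ndist arc_lengthxx. Qed.

Lemma ndist_triangle a b c : (ndist a c <= ndist a b + ndist b c)%N.
Proof.
have := ltn_ord a; have := ltn_ord b; have := ltn_ord c.
rewrite /ndist /arc_length; do !case: ifP; lia.
Qed.

Lemma ndist_gt0 a b : a != b -> (0 < ndist a b)%N.
Proof.
have := ltn_ord a; have := ltn_ord b.
by rewrite -val_eqE /= /ndist /arc_length; do !case: ifP; lia.
Qed.

Lemma ndist_le a b : (ndist a b <= M)%N.
Proof.
have := ltn_ord a; have := ltn_ord b.
by rewrite /ndist /arc_length; do !case: ifP; lia.
Qed.

(** Relational form of the neighbours; by uniqueness, any point with this property is the one found
    by walking. *)
Definition first_right u s r :=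
  r \in s /\ forall c, c \in s -> (arc_length u r <= arc_length u c)%N.

Definition first_left u s l :=
  l \in s /\ forall c, c \in s -> (arc_length l u <= arc_length c u)%N.

Lemma first_right_inj u s r r' : first_right u s r -> first_right u s r' -> r = r'.
Proof.
move=> [rs hr] [rs' hr']; apply/val_inj.
have := hr _ rs'; have := hr' _ rs.
have := ltn_ord r; have := ltn_ord r'; have := ltn_ord u.
by rewrite /= /arc_length; do !case: ifP; lia.
Qed.

Lemma first_left_inj u s r r' : first_left u s r -> first_left u s r' -> r = r'.
Proof.
move=> [rs hr] [rs' hr']; apply/val_inj.
have := hr _ rs'; have := hr' _ rs.
have := ltn_ord r; have := ltn_ord r'; have := ltn_ord u.
by rewrite /= /arc_length; do !case: ifP; lia.
Qed.

Lemma val_iter_ordS u k : (k < M)%N ->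
  val (iter k (@ordS M) u) = (if u + k < M then u + k else u + k - M)%N.
Proof.
elim: k => [|k IH] kM /=; first by rewrite addn0 ltn_ord.
rewrite IH; last exact: ltnW.
have := ltn_ord u => uM; case: ifP => h.
  case: ifP => h'; first by rewrite modn_small; lia.
  have -> : ((u + k).+1 = M)%N by lia.
  by rewrite modnn; lia.
by case: ifP => h'; rewrite ?modn_small; lia.
Qed.

Lemma val_iter_ord_pred u k : (k < M)%N ->
  val (iter k (@ord_pred M) u) = (if k <= u then u - k else u + M - k)%N.
Proof.
elim: k => [|k IH] kM /=; first by rewrite subn0.
rewrite IH; last exact: ltnW.
have := ltn_ord u => uM; case: ifP => h; case: ifP => h'; try lia.
- have -> : ((u - k + M).-1 = u - k.+1 + M)%N by lia.
  by rewrite modnDr modn_small; lia.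
- by rewrite modn_small; lia.
have -> : ((u + M - k + M).-1 = u + M - k.+1 + M)%N by lia.
by rewrite modnDr modn_small; lia.
Qed.

(* [g v] is the number of steps of the walk [f] from [u] to [v]. *)
Lemma head_traject (f : 'I_M -> 'I_M) (g : 'I_M -> nat) u s :
    (forall v, (g v < M)%N) ->
    (forall k, (k < M)%N -> g (iter k f u) = k) -> injective g ->
    (exists c, c \in s) ->
  let r := head u [seq v <- traject f u M | v \in s] in
  r \in s /\ forall c, c \in s -> (g r <= g c)%N.
Proof.
move=> gM gf gI [c cs] r.
have trajE : map g (traject f u M) = iota 0 M.
  apply: (@eq_from_nth _ 0%N) => [|i]; rewrite size_map size_traject ?size_iota //.
  by move=> iM; rewrite (nth_map u) ?size_traject // nth_traject // nth_iota // gf.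
have intraj v : v \in traject f u M.
  by rewrite -(mem_map gI) trajE mem_iota gM.
have : sorted (relpre g leq) [seq v <- traject f u M | v \in s].
  apply: sorted_filter => [a b e|]; first exact: leq_trans.
  by rewrite -sorted_map trajE iota_sorted.
rewrite /r; case E: [seq _ <- _ | _] => [|w q] /=.
  by have : c \in [::] by rewrite -E mem_filter cs intraj.
rewrite path_sortedE; last by move=> a b e; exact: leq_trans.
move=> /andP[/allP hw _]; split.
  by have := mem_head w q; rewrite -E mem_filter => /andP[].
move=> c' cs'; have : c' \in w :: q by rewrite -E mem_filter cs' intraj.
by rewrite inE => /orP[/eqP-> //|/hw].
Qed.

End Circle.

Lemma right_neighbourP (N M : nat) (u : 'I_M) (s : config N.+1 M) :
  first_right u (val s) (right_neighbour u s).
Proof.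
apply: (@head_traject _ _ (arc_length u)).
- by move=> v; exact: arc_length_lt.
- move=> k kM; rewrite /arc_length val_iter_ordS //; have := ltn_ord u.
  by do !case: ifP; lia.
- move=> v w; have := ltn_ord u; have := ltn_ord v; have := ltn_ord w.
  by rewrite /arc_length => ? ? ? h; apply/val_inj; move: h => /=; do !case: ifP; lia.
by exists (driver s ord0); exact: mem_tnth.
Qed.

Lemma left_neighbourP (N M : nat) (u : 'I_M) (s : config N.+1 M) :
  first_left u (val s) (left_neighbour u s).
Proof.
apply: (@head_traject _ _ ((@arc_length M)^~ u)).
- by move=> v; exact: arc_length_lt.
- move=> k kM; rewrite /arc_length val_iter_ord_pred //; have := ltn_ord u.
  by do !case: ifP; lia.
- move=> v w; have := ltn_ord u; have := ltn_ord v; have := ltn_ord w.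
  by rewrite /arc_length => ? ? ? h; apply/val_inj; move: h => /=; do !case: ifP; lia.
by exists (driver s ord0); exact: mem_tnth.
Qed.

(** Under either inequality, [b] lies on the arc travelled to the right from [a] to [c]. *)
Lemma arc_lengthD (M : nat) (a b c : 'I_M) :
    (arc_length a b <= arc_length a c)%N || (arc_length b c <= arc_length a c)%N ->
  arc_length a c = (arc_length a b + arc_length b c)%N.
Proof.
have := ltn_ord a; have := ltn_ord b; have := ltn_ord c.
by rewrite /arc_length; do !case: ifP; lia.
Qed.

(** A shortest path from [u] to [c] leaves [u] to the right or to the left, and so passes through
    [r] or [l]. *)
Lemma neighbour_on_geodesic (M : nat) (u r l c : 'I_M) (s : seq 'I_M) :
    first_right u s r -> first_left u s l -> c \in s ->
  (ndist u r + ndist r c <= ndist u c)%N \/ (ndist u l + ndist l c <= ndist u c)%N.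
Proof.
move=> [_ hr] [_ hl] cs.
have er := @arc_lengthD _ u r c; have el := @arc_lengthD _ c l u.
rewrite hr // in er; rewrite hl // orbT in el.
move: (er isT) (el isT); rewrite /ndist; lia.
Qed.

(** * Reflection of a user in the gap between its neighbours *)

Section Reflection.
Variable M : nat.
Implicit Types u l r : 'I_M.

(* l + r - u (mod M): the reflection that exchanges l and r. *)
Definition reflect_val (l r u : nat) : nat :=
  let w := (l + r + M - u)%N in
  if (w < M)%N then w else if (w < M + M)%N then (w - M)%N else (w - M - M)%N.

Lemma reflect_subproof l r u : (reflect_val l r u < M)%N.
Proof.
have := ltn_ord u; have := ltn_ord r; have := ltn_ord l.
by rewrite /reflect_val; do !case: ifP; lia.
Qed.

Definition reflect_ord l r u : 'I_M := Ordinal (reflect_subproof l r u).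

Lemma reflect_ordK l r : involutive (reflect_ord l r).
Proof.
move=> u; apply/val_inj => /=.
have := ltn_ord u; have := ltn_ord r; have := ltn_ord l.
by rewrite /reflect_val; do !case: ifP; lia.
Qed.

(** The reflection reverses the orientation and exchanges [l] and [r]. *)
Lemma arc_length_reflect l r u :
  [/\ arc_length l (reflect_ord l r u) = arc_length u r,
      arc_length (reflect_ord l r u) l = arc_length r u,
      arc_length r (reflect_ord l r u) = arc_length u l &
      arc_length (reflect_ord l r u) r = arc_length l u].
Proof.
have := ltn_ord u; have := ltn_ord r; have := ltn_ord l.
by rewrite /arc_length /= /reflect_val => *; split; do !case: ifP; lia.
Qed.

Lemma ndist_reflect l r u :
  ndist (reflect_ord l r u) l = ndist u r /\ ndist (reflect_ord l r u) r = ndist u l.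
Proof.
have [e1 e2 e3 e4] := arc_length_reflect l r u.
by rewrite /ndist e1 e2 e3 e4; split; exact: minnC.
Qed.

(** The reflected point stays on the arc from [l] to [r] through [u], which has no driver in its
    interior. *)
Lemma first_reflect (s : seq 'I_M) l r u :
    first_left u s l -> first_right u s r ->
  first_left (reflect_ord l r u) s l /\ first_right (reflect_ord l r u) s r.
Proof.
have [e1 e2 e3 e4] := arc_length_reflect l r u.
move=> [ls hl] [rs hr]; split; split=> // c cs; rewrite ?e1 ?e4 leqNgt; apply/negP => lt.
- have := @arc_lengthD _ l c (reflect_ord l r u).
  rewrite e1 (ltnW lt) orbT => /(_ isT).
  (* The two arcs between distinct points add up to [M], but both vanish between equal points; hence
     the case splits. *)
  have [clE|/arc_lengthC] := eqVneq c l; first by move: lt; rewrite clE e1 ltnn.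
  have := @arc_lengthD _ u r c; rewrite hr // => /(_ isT).
  have := @arc_lengthD _ c l u; rewrite hl // orbT => /(_ isT).
  have := hr _ ls; have := hr _ cs.
  have [-> |/arc_lengthC] := eqVneq c u; first by rewrite arc_lengthxx; lia.
  have [-> |/arc_lengthC] := eqVneq l u; first by rewrite arc_lengthxx; lia.
  by have := arc_length_lt u l; lia.
- have := @arc_lengthD _ (reflect_ord l r u) c r.
  rewrite e4 (ltnW lt) => /(_ isT).
  have [crE|/arc_lengthC] := eqVneq c r; first by move: lt; rewrite crE e4 ltnn.
  have := @arc_lengthD _ u r c; rewrite hr // => /(_ isT).
  have := @arc_lengthD _ c l u; rewrite hl // orbT => /(_ isT).
  have := hl _ rs; have := hl _ cs.
  have [-> |/arc_lengthC] := eqVneq c u; first by rewrite arc_lengthxx; lia.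
  have [-> |/arc_lengthC] := eqVneq r u; first by rewrite arc_lengthxx; lia.
  by have := arc_length_lt r u; lia.
Qed.

End Reflection.

(** * Discounted values *)

Section Distance.
Variables (R : realType) (M : nat).
Implicit Types a b c u : 'I_M.

Lemma size_circle_gt0 u : 0 < (M%:R : R).
Proof. by rewrite ltr0n; apply: leq_ltn_trans (ltn_ord u). Qed.

Lemma dist_ge0 a b : 0 <= dist R a b.
Proof. by rewrite distE divr_ge0. Qed.

Lemma dist_le1 a b : dist R a b <= 1.
Proof. by rewrite distE ler_pdivrMr ?mul1r ?ler_nat ?ndist_le ?(size_circle_gt0 a). Qed.

Lemma distxx a : dist R a a = 0.
Proof. by rewrite distE ndistxx mul0r. Qed.

Lemma distC a b : dist R a b = dist R b a.
Proof. by rewrite !distE ndistC. Qed.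

Lemma dist_triangle a b c : dist R a c <= dist R a b + dist R b c.
Proof.
by rewrite !distE -mulrDl -natrD ler_pM2r ?invr_gt0 ?(size_circle_gt0 a) // ler_nat ndist_triangle.
Qed.

Lemma dist_lb a b : a != b -> M%:R^-1 <= dist R a b.
Proof.
move=> ab; rewrite distE ler_pdivlMr ?(size_circle_gt0 a) // mulVf ?gt_eqF ?(size_circle_gt0 a) //.
by rewrite ler1n ndist_gt0.
Qed.

Lemma ler_dist a b c u : (dist R a b <= dist R c u) = (ndist a b <= ndist c u)%N.
Proof. by rewrite !distE ler_pM2r ?invr_gt0 ?(size_circle_gt0 a) // ler_nat. Qed.

End Distance.

(** * Means over locations and minima over drivers *)

Section Mean.
Variables (R : realType) (M : nat) (Q : 'I_M -> R).
Hypothesis Q_gt0 : forall a, 0 < Q a.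
Hypothesis Q_sum : \sum_a Q a = 1.

Definition mean (F : 'I_M -> R) : R := \sum_a Q a * F a.

Lemma mean_cst c : mean (fun=> c) = c.
Proof. by rewrite /mean -mulr_suml Q_sum mul1r. Qed.

Lemma meanD F G : mean (fun a => F a + G a) = mean F + mean G.
Proof. by rewrite /mean -big_split; apply: eq_bigr => a _; rewrite mulrDr. Qed.

Lemma meanZ c F : mean (fun a => c * F a) = c * mean F.
Proof. by rewrite /mean mulr_sumr; apply: eq_bigr => a _; rewrite mulrCA. Qed.

Lemma ler_mean F G : (forall a, F a <= G a) -> mean F <= mean G.
Proof. by move=> FG; apply: ler_sum => a _; rewrite ler_pM2l. Qed.

Lemma ler_mean_shift c F G : (forall a, F a <= G a + c) -> mean F <= mean G + c.
Proof. by move=> FG; rewrite -[X in _ + X]mean_cst -meanD ler_mean. Qed.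

(** The location [a] has weight at least [p], so a gain [e] there alone lowers the mean by [p * e];
    strictness at one event is propagated this way. *)
Lemma ler_mean_gap p c e a F G : p <= Q a -> 0 <= e ->
  (forall a, F a <= G a + c) -> F a <= G a + c - e -> mean F <= mean G + c - p * e.
Proof.
move=> pQ e0 FG FGa.
have : mean F <= mean (fun b => G b + c - (b == a)%:R * e).
  apply: ler_mean => b; case: eqP => [->|_]; first by rewrite mul1r.
  by rewrite mul0r subr0.
move/le_trans; apply.
have -> : mean (fun b => G b + c - (b == a)%:R * e) = mean G + c - Q a * e.
  rewrite -[X in _ = _ + X - _]mean_cst -meanD /mean.
  rewrite (eq_bigr (fun b => Q b * (G b + c) - Q b * ((b == a)%:R * e))); last first.
    by move=> b _; rewrite mulrBr.
  rewrite sumrB; congr (_ - _); rewrite (bigD1 a) //= eqxx mul1r big1 ?addr0 //.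
  by move=> b /negPf ->; rewrite mul0r mulr0.
by rewrite lerB // ler_wpM2r.
Qed.

End Mean.

Section ArgMin.
Variables (R : realType) (N : nat).
Implicit Types F G : 'I_N.+1 -> R.

Definition argmin F : 'I_N.+1 := [arg min_(i < ord0) F i]%O.

Definition minval F : R := F (argmin F).

Lemma minval_le F i : minval F <= F i.
Proof. by rewrite /minval /argmin; case: Order.TotalTheory.arg_minP => // j _; apply. Qed.

Lemma le_minval F c : (forall i, c <= F i) -> c <= minval F.
Proof. by apply. Qed.

Lemma minval_eq F i : (forall j, F i <= F j) -> minval F = F i.
Proof. by move=> h; apply/eqP; rewrite eq_le minval_le le_minval. Qed.

Lemma ler_minval_shift F G c : (forall i, F i <= G i + c) -> minval F <= minval G + c.
Proof. by move=> FG; apply: le_trans (FG _); exact: minval_le. Qed.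

End ArgMin.

(** * Value iteration: Lipschitz bound and its strict form *)

Section ValueIteration.
Variables (R : realType) (N M : nat) (Q P : 'I_M -> R).
Hypotheses (lawQ : full_support_law Q) (lawP : full_support_law P).
Variable b : R.
Hypotheses (b_ge0 : 0 <= b) (b_le1 : b <= 1).

Local Notation drivers := ('I_N.+1 -> 'I_M).
Implicit Types (f g : drivers) (u a y : 'I_M) (i j : 'I_N.+1).

Definition upd f k y : drivers := fun i => if i == k then y else f i.

Lemma upd_same f k y : upd f k y k = y.
Proof. by rewrite /upd eqxx. Qed.

Lemma upd_id f k : upd f k (f k) = f.
Proof. by apply/funext => i; rewrite /upd; case: eqP => [->|]. Qed.

Lemma upd_upd f k y y' : upd (upd f k y) k y' = upd f k y'.
Proof. by apply/funext => i; rewrite /upd; case: eqP. Qed.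

Lemma updC f k l y y' : k != l -> upd (upd f k y) l y' = upd (upd f l y') k y.
Proof.
move=> kl; apply/funext => i; rewrite /upd; case: (eqVneq i l) => // ->.
by rewrite eq_sym (negPf kl).
Qed.

Lemma upd_perm f (s : {perm 'I_N.+1}) k y : upd (f \o s) k y = upd f (s k) y \o s.
Proof. by apply/funext => i; rewrite /upd /= (inj_eq perm_inj). Qed.

(** Serving with [k] rather than [i] leaves, up to an exchange of labels, one driver at [f i]
    instead of [f k]. *)
Lemma upd_tperm f i k y : i != k ->
  upd f k y = upd (upd f i y) k (f i) \o tperm i k.
Proof.
move=> ik; apply/funext => j; rewrite /upd /=; case: tpermP => [->|->|].
- by rewrite eqxx (negPf ik).
- by rewrite !eqxx (negPf ik).
by move=> /eqP/negPf-> /eqP/negPf->.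
Qed.

(* The drivers are labelled, and not sorted: by value_perm, the final sort in
   step does not affect the values. *)
Fixpoint value (n : nat) f : R :=
  if n is n'.+1 then
    mean Q (fun u => minval (fun k =>
      dist R u (f k) + b * mean P (fun y => value n' (upd f k y))))
  else 0.

Definition action_value n f u k : R :=
  dist R u (f k) + b * mean P (fun y => value n (upd f k y)).

Lemma valueS n f : value n.+1 f = mean Q (fun u => minval (action_value n f u)).
Proof. by []. Qed.

Let Q_gt0 := lawQ.1.
Let Q_sum := lawQ.2.
Let P_gt0 := lawP.1.
Let P_sum := lawP.2.

Lemma value_perm n f (s : {perm 'I_N.+1}) : value n (f \o s) = value n f.
Proof.
elim: n f => // n IH f; rewrite !valueS; congr mean; apply/funext => u.
have E i : action_value n (f \o s) u i = action_value n f u (s i).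
  rewrite /action_value /=; congr (_ + _ * mean P _); apply/funext => y.
  by rewrite upd_perm IH.
apply/eqP; rewrite eq_le; apply/andP; split; apply: le_minval => i.
  by rewrite -(permKV s i) -E minval_le.
by rewrite E minval_le.
Qed.

Lemma value_swap n f i k y : i != k ->
  value n (upd f k y) = value n (upd (upd f i y) k (f i)).
Proof. by move=> ik; rewrite (upd_tperm f y ik) value_perm. Qed.

Lemma ler_action_value n f g u i k c : dist R u (f i) <= dist R u (g k) + c ->
    (forall y, value n (upd f i y) <= value n (upd g k y)) ->
  action_value n f u i <= action_value n g u k + c.
Proof.
move=> h1 h2; rewrite /action_value addrAC lerD // ler_wpM2l //.
exact: ler_mean.
Qed.

Lemma ler_action_value_shift n f g u i k c : 0 <= c -> dist R u (f i) <= dist R u (g k) ->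
    (forall y, value n (upd f i y) <= value n (upd g k y) + c) ->
  action_value n f u i <= action_value n g u k + c.
Proof.
move=> c0 h1 h2; rewrite /action_value -addrA lerD //.
apply: (@le_trans _ _ (b * (mean P (fun y => value n (upd g k y)) + c))).
  by rewrite ler_wpM2l //; apply: ler_mean_shift.
by rewrite mulrDr lerD2l ler_piMl.
Qed.

(** The configuration with a driver at [a] imitates the other one. If the other uses driver [j], the
    triangle inequality pays [dist R a c] now and the configurations merge; otherwise the costs
    agree and the displacement persists. *)
Lemma minval_upd_le n f j a c u :
    (forall f j, value n (upd f j a) <= value n (upd f j c) + dist R a c) ->
  minval (action_value n (upd f j a) u) <=
    minval (action_value n (upd f j c) u) + dist R a c.
Proof.
move=> IH; apply: ler_minval_shift => k; have [->|kj] := eqVneq k j.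
  apply: ler_action_value => [|y]; last by rewrite !upd_upd.
  by rewrite !upd_same [dist R a c]distC dist_triangle.
apply: ler_action_value_shift => [||y]; first exact: dist_ge0.
  by rewrite /upd (negPf kj).
by rewrite ![upd (upd f j _) _ _]updC // eq_sym.
Qed.

Lemma value_upd_le n f j a c :
  value n (upd f j a) <= value n (upd f j c) + dist R a c.
Proof.
elim: n f j => [|n IH] f j; first by rewrite add0r dist_ge0.
by rewrite !valueS; apply: ler_mean_shift => // u; exact: minval_upd_le.
Qed.

Lemma value_replace_le n f i k y :
  value n (upd f k y) <= value n (upd f i y) + dist R (f i) (f k).
Proof.
have [->|ik] := eqVneq i k; first by rewrite lerDl dist_ge0.
rewrite (value_swap _ _ _ ik).
apply: le_trans (value_upd_le _ _ _ _ (f k)) _.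
rewrite lerD2r; have -> // : upd (upd f i y) k (f k) = upd f i y.
by apply/funext => l; rewrite /upd; case: (eqVneq l k) => // ->; rewrite eq_sym (negPf ik).
Qed.

(** Another driver [i] costs [dist R u (f i)] now, while the configuration it leaves is better by at
    most that distance, discounted. *)
Lemma action_value_exact n f u k : f k = u ->
  minval (action_value n f u) = action_value n f u k.
Proof.
move=> fk; apply: minval_eq => i.
rewrite /action_value fk distxx add0r.
apply: (@le_trans _ _ (b * (mean P (fun y => value n (upd f i y)) + dist R u (f i)))).
  rewrite ler_wpM2l //; apply: ler_mean_shift => // y.
  by rewrite -fk distC; exact: value_replace_le.
by rewrite mulrDr addrC lerD2r ler_piMl // dist_ge0.
Qed.

Variable p : R.
Hypotheses (p_gt0 : 0 < p) (pQ : forall a, p <= Q a) (pP : forall a, p <= P a).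
Hypothesis b_half : 2^-1 <= b.

Lemma p_le1 (a : 'I_M) : p <= 1.
Proof.
apply: le_trans (pQ a) _; rewrite -Q_sum (bigD1 a) //= lerDl.
by apply: sumr_ge0 => c _; exact: ltW.
Qed.

(** The margin when [k] other drivers must still be brought to the common place. Each contributes a
    factor [p] for a user, [p] for a new driver and 1/2 for the discount; the base is [p], for a
    last user, times the least positive distance. *)
Definition swap_gain (k : nat) : R := (p ^+ 2 / 2) ^+ k * (p / M%:R).

Lemma swap_gain_ge0 k : 0 <= swap_gain k.
Proof. by rewrite mulr_ge0 ?exprn_ge0 ?divr_ge0 ?exprn_ge0 // ltW. Qed.

Lemma swap_gain_gt0 (a : 'I_M) k : 0 < swap_gain k.
Proof. by rewrite mulr_gt0 ?exprn_gt0 ?divr_gt0 ?exprn_gt0 ?(size_circle_gt0 R a). Qed.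

Lemma swap_gain_anti (a : 'I_M) (k l : nat) : (k <= l)%N -> swap_gain l <= swap_gain k.
Proof.
move=> kl; rewrite /swap_gain ler_wpM2r ?divr_ge0 ?(ltW p_gt0) //.
apply: ler_wiXn2l => //; first by rewrite divr_ge0 ?exprn_ge0 // ltW.
have p1 := p_le1 a.
by rewrite ler_pdivrMr // mul1r (le_trans (exprn_ile1 2 (ltW p_gt0) p1)) // ler1n.
Qed.

(* Bring all the other drivers to c by exact matchings, then let a user
   appear at a: the configuration with a driver at a saves the distance from a to c
   instead of losing it. *)
Lemma value_upd_lt (k n : nat) f j a c : a != c -> (k < n)%N ->
    #|[pred i | (i != j) && (f i != c)]| = k ->
  value n (upd f j a) <= value n (upd f j c) + dist R a c - swap_gain k.
Proof.
move=> ac; elim: k n f => [|k IH] [//|n] f kn cardE.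
(* All drivers other than [j] are at [c]: against a user at [a], the second configuration pays
   [dist R a c] whatever it does, and ends where the first one does. *)
- have fc i : i != j -> f i = c.
    move=> ij; apply/eqP; have /eqP := cardE; rewrite -leqn0 leqNgt; apply: contraR => fi.
    by apply/card_gt0P; exists i; rewrite inE ij.
  rewrite !valueS /swap_gain mul1r.
  apply: (@ler_mean_gap _ _ _ Q_gt0 Q_sum p (dist R a c) M%:R^-1 a); rewrite ?invr_ge0 //.
    by move=> u; apply: minval_upd_le => g l; exact: value_upd_le.
  rewrite (@action_value_exact _ _ _ j) ?upd_same //.
  rewrite {1}/action_value upd_same distxx add0r.
  have -> : (fun y => value n (upd (upd f j a) j y)) = fun y => value n (upd f j y).
    by apply/funext => y; rewrite upd_upd.
  rewrite -addrA -lerBlDr; apply: le_minval => k.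
  have dk : upd f j c k = c by rewrite /upd; case: eqP => // /eqP; exact: fc.
  rewrite /action_value dk.
  have -> : (fun y => value n (upd (upd f j c) k y)) = fun y => value n (upd f j y).
    apply/funext => y; have [->|kj] := eqVneq k j; first by rewrite upd_upd.
    rewrite (value_swap _ _ _ (i := j)); last by rewrite eq_sym.
    have e : upd f j y k = c by rewrite /upd (negPf kj) fc.
    by rewrite upd_upd upd_same -e upd_id.
  by have := dist_lb R ac; have := dist_ge0 R a c; lra.
(* A user at [f i] is matched exactly to driver [i] in both configurations; if the new driver
   arrives at [c], one driver fewer remains to be moved. *)
have [i] : exists i, i \in [pred i | (i != j) && (f i != c)].
  by apply/card_gt0P; rewrite cardE.
rewrite inE => /andP[ij fi].
have dac := dist_ge0 R a c.
have -> : swap_gain k.+1 = p * (p / 2 * swap_gain k).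
  by rewrite /swap_gain exprS; move: (p / M%:R) => z; field.
rewrite !valueS.
apply: (@ler_mean_gap _ _ _ Q_gt0 Q_sum p (dist R a c) (p / 2 * swap_gain k) (f i)).
- exact: pQ.
- by apply: mulr_ge0; [apply: divr_ge0; rewrite ?(ltW p_gt0)|exact: swap_gain_ge0].
- by move=> u; apply: minval_upd_le => g l; exact: value_upd_le.
have upd_i z : upd f j z i = f i by rewrite /upd (negPf ij).
rewrite !(@action_value_exact _ _ _ i) // /action_value !upd_i distxx !add0r.
have : mean P (fun y => value n (upd (upd f j a) i y)) <=
       mean P (fun y => value n (upd (upd f j c) i y)) + dist R a c - p * swap_gain k.
  apply: (@ler_mean_gap _ _ _ P_gt0 P_sum p (dist R a c) _ c) => //.
  - exact: swap_gain_ge0.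
  - by move=> y; rewrite ![upd (upd f j _) i _]updC ?value_upd_le // eq_sym.
  rewrite ![upd (upd f j _) i _]updC; try by rewrite eq_sym.
  apply: IH => //; move: cardE; rewrite (cardD1 i) !inE ij fi /= add1n => -[<-].
  apply: eq_card => l; rewrite !inE /upd.
  by case: (eqVneq l i) => [->|] //=; rewrite eqxx andbF.
have := mulr_ge0 (ltW p_gt0) (swap_gain_ge0 k).
move: (mean _ _) (mean _ _) (swap_gain k) => B A e pe AB.
have : b * A <= b * (B + dist R a c - p * e) by exact: ler_wpM2l.
have : 2^-1 * (p * e) <= b * (p * e) by exact: ler_wpM2r.
have : b * dist R a c <= dist R a c by rewrite ler_piMl.
have -> : p / 2 * e = 2^-1 * (p * e) by field.
rewrite !mulrBr mulrDr; lra.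
Qed.

Lemma value_upd_lt_unif n f j a c : a != c -> (N < n)%N ->
  value n (upd f j a) <= value n (upd f j c) + dist R a c - swap_gain N.
Proof.
move=> ac Nn; set k := #|[pred i | (i != j) && (f i != c)]|.
have kN : (k <= N)%N.
  have <- : #|predC1 j| = N by rewrite cardC1 card_ord.
  by apply/subset_leq_card/fintype.subsetP => i; rewrite !inE => /andP[->].
apply: le_trans (value_upd_lt ac (leq_ltn_trans kN Nn) (erefl k)) _.
by rewrite lerD2l lerN2 (swap_gain_anti a).
Qed.

(** Driver [k] lies on a shortest path from [u] to driver [i]. Serving by [k] saves
    [dist R (f k) (f i)] at once, and what is left behind is worse by less than this, with margin
    [swap_gain]; the factor 1/2 bounds the discount. *)
Lemma action_value_between n f u i k : (N < n)%N -> f k != f i ->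
    dist R u (f k) + dist R (f k) (f i) <= dist R u (f i) ->
  minval (action_value n f u) + 2^-1 * swap_gain N <= action_value n f u i.
Proof.
move=> Nn fki duk.
have ki : i != k by apply: contraNneq fki => ->.
have fik : f i != f k by rewrite eq_sym.
rewrite -lerBrDr; apply: le_trans (minval_le _ k) _; rewrite /action_value.
have : mean P (fun y => value n (upd f k y)) <=
    mean P (fun y => value n (upd f i y)) + (dist R (f k) (f i) - swap_gain N).
  apply: ler_mean_shift => // y; rewrite (value_swap _ _ _ ki) addrA.
  apply: le_trans (value_upd_lt_unif _ _ fik Nn) _.
  rewrite distC; have -> // : upd (upd f i y) k (f k) = upd f i y.
  by apply/funext => l; rewrite /upd; case: (eqVneq l k) => // ->; rewrite eq_sym (negPf ki).
move: (mean _ _) (mean _ _) (swap_gain_ge0 N) => B A e0 AB.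
have : b * A <= b * (B + (dist R (f k) (f i) - swap_gain N)) by rewrite ler_wpM2l.
have : b * dist R (f k) (f i) <= dist R (f k) (f i) by rewrite ler_piMl // dist_ge0.
have : 2^-1 * swap_gain N <= b * swap_gain N by rewrite ler_wpM2r.
rewrite mulrDr mulrBr; lra.
Qed.

Lemma value_ge0 n f : 0 <= value n f.
Proof.
elim: n f => // n IH f; rewrite valueS; apply: sumr_ge0 => u _.
rewrite mulr_ge0 ?(ltW (Q_gt0 _)) //; apply: le_minval => k.
rewrite addr_ge0 ?dist_ge0 // mulr_ge0 //; apply: sumr_ge0 => y _.
by rewrite mulr_ge0 ?(ltW (P_gt0 _)).
Qed.

(** A single stage costs between 0 and 1, and each Bellman step scales the difference of consecutive
    iterates by at most [b]. *)
Lemma value_incr n f : value n f <= value n.+1 f <= value n f + b ^+ n.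
Proof.
elim: n f => [|n IH] f.
  rewrite expr0; apply/andP; split; first exact: value_ge0.
  rewrite [leLHS]valueS add0r; apply: le_trans (ler_mean Q_gt0 (G := fun=> 1) _) _.
    move=> u; apply: le_trans (minval_le _ ord0) _.
    rewrite /action_value /=.
    by rewrite (mean_cst P_sum) mulr0 addr0 dist_le1.
  by rewrite mean_cst.
rewrite [X in _ <= X <= _]valueS [X in X <= _]valueS [X in _ <= X + _]valueS.
apply/andP; split.
  apply: ler_mean => // u; apply: le_minval => k; apply: le_trans (minval_le _ k) _.
  rewrite lerD2l ler_wpM2l //; apply: ler_mean => // y.
  by case/andP: (IH (upd f k y)).
apply: ler_mean_shift => // u; apply: ler_minval_shift => k.
rewrite /action_value -addrA lerD2l exprS -mulrDr ler_wpM2l //.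
by apply: ler_mean_shift => // y; case/andP: (IH (upd f k y)).
Qed.

Lemma value_span n f g : value n f <= value n g + N.+1%:R.
Proof.
(* Interpolate from [g] to [f] one driver at a time; each move costs at most 1. *)
pose h k : drivers := fun i => if (i < k)%N then f i else g i.
have -> : f = h N.+1 by apply/funext => i; rewrite /h ltn_ord.
have : (N.+1 <= N.+1)%N by [].
elim: {1 3 4}N.+1 => [|k IH] kN.
  have -> : h 0%N = g by apply/funext.
  by rewrite addr0.
have -> : h k.+1 = upd (h k) (Ordinal kN) (f (Ordinal kN)).
  apply/funext => i; rewrite /upd /h ltnS leq_eqVlt -val_eqE /=.
  by case: eqP => //= e; congr f; exact: val_inj.
apply: le_trans (value_upd_le _ _ _ _ (h k (Ordinal kN))) _.
rewrite upd_id -natr1 addrA lerD ?dist_le1 // IH //; exact: ltnW.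
Qed.

End ValueIteration.

(** * Averages along a finite Markov chain *)

Section MarkovOperator.
Variables (R : realType) (S : finType).
Implicit Types (v w c h : S -> R) (A : (S -> R) -> S -> R).

(** A stochastic matrix, seen through its action on functions. *)
Definition markov_operator A : Prop :=
  [/\ forall a v w, A (fun s => a * v s + w s) = fun s => a * A v s + A w s,
      forall v w, (forall s, v s <= w s) -> forall s, A v s <= A w s &
      forall a, A (fun=> a) = fun=> a].

Variable A : (S -> R) -> S -> R.
Hypothesis A_markov : markov_operator A.

Lemma markovP a v w s : A (fun s => a * v s + w s) s = a * A v s + A w s.
Proof. by case: A_markov => ->. Qed.

Lemma markov_le v w s : (forall s, v s <= w s) -> A v s <= A w s.
Proof. by case: A_markov => _ h _ /h. Qed.

Lemma markov_cst a s : A (fun=> a) s = a.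
Proof. by case: A_markov => _ _ ->. Qed.

Lemma markovZ a v s : A (fun s => a * v s) s = a * A v s.
Proof.
have := markovP a v (fun=> 0) s; rewrite markov_cst addr0 => <-.
by congr A; apply/funext => t; rewrite addr0.
Qed.

Lemma markovD v w s : A (fun s => v s + w s) s = A v s + A w s.
Proof.
have := markovP 1 v w s; rewrite mul1r => <-.
by congr A; apply/funext => t; rewrite mul1r.
Qed.

Lemma markov_sum (I : Type) (r : seq I) (v : I -> S -> R) s :
  A (fun s => \sum_(i <- r) v i s) s = \sum_(i <- r) A (v i) s.
Proof.
elim: r => [|i r IH].
  rewrite big_nil -[RHS](markov_cst 0 s).
  by congr A; apply/funext => t; rewrite big_nil.
rewrite big_cons -IH -markovD.
by congr A; apply/funext => t; rewrite big_cons.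
Qed.

Lemma iter_markov t : markov_operator (iter t A).
Proof.
elim: t => [|t [IH1 IH2 IH3]]; first by split.
split=> [a v w|v w vw s|a] /=.
- by rewrite IH1; apply/funext => s; rewrite markovP.
- by apply: markov_le => s'; exact: IH2.
- by rewrite IH3; apply/funext => s; rewrite markov_cst.
Qed.

Lemma markov_norm_le C v : (forall s, `|v s| <= C) -> forall s, `|A v s| <= C.
Proof.
move=> vC s; rewrite ler_norml; apply/andP; split.
  rewrite -[leLHS](markov_cst _ s); apply: markov_le => t.
  by have := vC t; rewrite ler_norml => /andP[].
rewrite -[leRHS](markov_cst _ s); apply: markov_le => t.
by have := vC t; rewrite ler_norml => /andP[].
Qed.

Lemma fun_bounded v : exists C, forall s, `|v s| <= C.
Proof.
exists (\sum_s `|v s|) => s; rewrite (bigD1 s) //= lerDl; exact: sumr_ge0.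
Qed.

Definition time_average c s (T : nat) : R := T%:R^-1 * \sum_(t < T) iter t A c s.

Lemma eq0_of_bounded_mulrn (x C : R) : (forall T : nat, `|T%:R * x| <= C) -> x = 0.
Proof.
move=> h; apply/eqP; rewrite -normr_le0 leNgt; apply/negP => x0.
have := h (Num.truncn (C / `|x|)).+1.
rewrite normrM normr_nat leNgt => /negP; apply.
by rewrite -ltr_pdivrMr // truncnS_gt.
Qed.

Local Open Scope classical_set_scope.

(* 1 - A is a bijection of its image, since A is a contraction; so the kernel
   and the image of 1 - A are supplementary. *)
Lemma ergodic_decomposition c :
  exists a w, (forall s, A a s = a s) /\ (forall s, c s = a s + (w s - A w s)).
Proof.
pose V : vectType R := {ffun S -> R^o}.
pose F (v : V) : V := [ffun s => A v s].
have F_lin : linear F.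
  move=> a v w; apply/ffunP => s; rewrite !ffunE -markovP.
  by congr A; apply/funext => t; rewrite !ffunE.
pose G : {linear V -> V} := HB.pack F (GRing.isLinear.Build R V V _ F F_lin).
pose B : 'End(V) := (\1 - linfun G)%VF.
have BE (v : V) : B v = v - F v by rewrite add_lfunE opp_lfunE id_lfunE lfunE.
(* If v = A v and v = w - A w, then T v = w - A^T w is bounded in T, so v = 0. *)
have disj : (lker B :&: limg B = 0)%VS.
  apply/eqP; rewrite -subv0; apply/subvP => v; rewrite memv_cap memv_ker BE subr_eq0.
  move=> /andP[/eqP vF /memv_imgP[w _]]; rewrite BE => vE.
  rewrite memv0; apply/eqP/ffunP => s; rewrite ffunE.
  have itE t : iter t A v = v.
    by elim: t => //= n ->; apply/funext => r; rewrite [in RHS]vF ffunE.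
  have [C wC] := fun_bounded w.
  apply: (@eq0_of_bounded_mulrn _ (C + C)) => T.
  have -> : T%:R * v s = w s - iter T A w s.
    elim: T => [|T IH]; first by rewrite mul0r subrr.
    rewrite -natr1 mulrDl mul1r IH /=.
    have : iter T A v s = iter T A w s - A (iter T A w) s.
      have -> : (v : S -> R) = (fun s => (-1) * A w s + w s).
        by apply/funext => r; rewrite {1}vE !ffunE mulN1r addrC.
      by case: (iter_markov T) => -> _ _; rewrite mulN1r addrC -iterSr.
    rewrite itE => ->; lra.
  apply: le_trans (ler_normB _ _) _; apply: lerD => //.
  elim: (T) s => //= n IHn; exact: markov_norm_le.
(* By rank-nullity, the dimensions add up. *)
have full : (lker B + limg B = fullv)%VS.
  apply/eqP; rewrite -dimv_leqif_eq ?subvf // (dimv_disjoint_sum disj).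
  by rewrite -(limg_ker_dim B fullv) capfv.
pose cV : V := [ffun s => c s].
have : cV \in (lker B + limg B)%VS by rewrite full memvf.
move=> /memv_addP[a]; rewrite memv_ker BE subr_eq0 => /eqP aF [z /memv_imgP[w _]].
rewrite BE => -> cE; exists a, w; split=> s.
  by rewrite {2}aF ffunE.
by have /ffunP/(_ s) := cE; rewrite !ffunE.
Qed.

Lemma time_average_coboundary c a w s (T : nat) :
    (forall s, A a s = a s) -> (forall s, c s = a s + (w s - A w s)) ->
  \sum_(t < T) iter t A c s = T%:R * a s + (w s - iter T A w s).
Proof.
move=> aA cE; have -> : c = fun s => 1 * a s + ((-1) * A w s + w s).
  by apply/funext => r; rewrite cE mulN1r mul1r; congr (_ + _); rewrite addrC.
elim: T => [|T IH]; first by rewrite big_ord0 mul0r subrr addr0.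
rewrite big_ord_recr IH /=; case: (iter_markov T) => L _ _; rewrite !L.
have -> : iter T A a = a.
  by elim: (T) => //= n ->; exact/funext.
rewrite -iterSr -natr1 mulrDl /=; lra.
Qed.

Lemma cvg_div_bounded (u : nat -> R) C :
  (forall T, `|u T| <= C) -> (fun T : nat => T%:R^-1 * u T) @ \oo --> (0 : R).
Proof.
move=> uC; apply/norm_cvg0P.
apply: (@squeeze_cvgr _ _ _ _ (fun=> 0) (fun T : nat => T%:R^-1 * C)).
- apply: nearW => T; rewrite normr_ge0 normrM ger0_norm ?invr_ge0 //=.
  by rewrite ler_wpM2l ?invr_ge0.
- exact: cvg_cst.
rewrite -[X in _ --> X](mul0r C); apply: cvgMl.
by rewrite -cvg_shiftS; exact: cvg_harmonic.
Qed.

Lemma iter_markov_diff w s :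
  exists C, forall T, `|w s - iter T A w s| <= C.
Proof.
have [C wC] := fun_bounded w; exists (C + C) => T.
apply: le_trans (ler_normB _ _) _; apply: lerD => //.
elim: T s => //= n IHn; exact: markov_norm_le.
Qed.

(** In the decomposition, the invariant part is the limit; the part [w - A w] telescopes to a
    bounded sum. *)
Lemma time_average_cvg c : exists a : S -> R, forall s, time_average c s @ \oo --> a s.
Proof.
have [a [w [aA cE]]] := ergodic_decomposition c; exists a => s.
have [C wC] := iter_markov_diff w s.
have h : (fun T : nat => a s + T%:R^-1 * (w s - iter T A w s)) @ \oo --> a s.
  rewrite -[X in _ --> X]addr0; apply: cvgD; first exact: cvg_cst.
  exact: cvg_div_bounded wC.
apply: cvg_trans h; apply: near_eq_cvg; near=> T.
have T0 : (T%:R : R) != 0 by rewrite pnatr_eq0 -lt0n; near: T; exists 1%N.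
by rewrite /time_average (time_average_coboundary _ _ aA cE) [RHS]mulrDr mulKf.
Unshelve. all: by end_near. Qed.

(** The potential [h] certifies the bound: its inequality, summed along the iterates of [A],
    telescopes to a bounded remainder. *)
Lemma time_average_le c a s k h : time_average c s @ \oo --> a ->
  (forall s, c s + A h s <= h s + k) -> a <= k.
Proof.
move=> ca ch; have [C hC] := iter_markov_diff h s.
have kC : (fun T : nat => k + T%:R^-1 * (h s - iter T A h s)) @ \oo --> k.
  rewrite -[X in _ --> X]addr0; apply: cvgD; first exact: cvg_cst.
  exact: cvg_div_bounded hC.
apply: ler_cvg_to ca kC _; near=> T.
have T0 : 0 < (T%:R : R) by rewrite ltr0n; near: T; exists 1%N.
rewrite /time_average -ler_pdivlMl ?invr_gt0 // invrK mulrDr mulVKf ?gt_eqF //.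
elim: (T) => [|n IH]; first by rewrite big_ord0 mul0r subrr addr0.
rewrite big_ord_recr -natr1 mulrDl mul1r /=.
have : iter n A c s <= k + (iter n A h s - A (iter n A h) s).
  case: (iter_markov n) => L Mo K.
  have -> : k + (iter n A h s - A (iter n A h) s) =
     iter n A (fun s => (-1) * A h s + (1 * h s + k)) s.
    by rewrite !L K mulN1r mul1r -iterSr /=; lra.
  by apply: Mo => r; have := ch r; lra.
lra.
Unshelve. all: by end_near. Qed.

Lemma time_average_ge c a s k h : time_average c s @ \oo --> a ->
  (forall s, h s + k <= c s + A h s) -> k <= a.
Proof.
move=> ca ch; rewrite -lerN2.
have NcE : time_average (fun s => (-1) * c s + 0) s = fun T => - time_average c s T.
  apply/funext => T; rewrite /time_average -mulrN -sumrN; congr (_ * _).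
  by apply: eq_bigr => t _; case: (iter_markov t) => -> _ ->; rewrite mulN1r addr0.
apply: (@time_average_le (fun s => (-1) * c s + 0) _ s _ (fun s => (-1) * h s)).
  by rewrite NcE; exact: cvgN.
by move=> r; rewrite markovZ; have := ch r; lra.
Qed.

End MarkovOperator.

(** * Policies without uniform loss *)
Section Recurrence.
Variables (R : realType) (S : finType) (A : (S -> R) -> S -> R) (B : pred S).
Hypothesis A_markov : markov_operator A.

Definition visits (k : nat) : S -> R :=
  fun s => \sum_(j < k) iter j A (fun s => (B s)%:R) s.

Lemma visits_ge0 k s : 0 <= visits k s.
Proof.
apply: sumr_ge0 => j _; case: (iter_markov A_markov j) => _ Mo K.
have := Mo (fun=> 0) (fun s => (B s)%:R); rewrite K; apply => r; exact: ler0n.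
Qed.

Lemma visitsS k s : visits k.+1 s = (B s)%:R + A (visits k) s.
Proof. by rewrite /visits big_ord_recl /= markov_sum. Qed.

(** Turns recurrence into a drift inequality. For [psi] take the mean of [visits k] over k < n: the
    increments A (visits k) + 1_B - visits k sum to [visits n]. *)
Lemma visits_potential (n : nat) (q : R) : (0 < n)%N -> (forall s, q <= visits n s) ->
  exists psi : S -> R, forall s, psi s + q / n%:R <= A psi s + (B s)%:R.
Proof.
move=> n0 qv; have nR : 0 < (n%:R : R) by rewrite ltr0n.
exists (fun s => n%:R^-1 * \sum_(k < n) visits k s) => s.
rewrite markovZ // markov_sum // [q / _]mulrC -mulrDr ler_pdivrMl // mulrDr mulVKf ?gt_eqF //.
have -> : n%:R * (B s)%:R = \sum_(k < n) (B s)%:R :> R.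
  by rewrite sumr_const card_ord mulr_natl.
rewrite [leRHS]addrC -big_split /=.
have -> : \sum_(k < n) ((B s)%:R + A (visits k) s) =
          \sum_(k < n) visits k s + visits n s.
  rewrite (_ : visits n s = \sum_(k < n) iter k A (fun s => (B s)%:R) s) // -big_split /=.
  by apply: eq_bigr => k _; rewrite -visitsS /visits big_ord_recr.
by rewrite lerD2l.
Qed.

End Recurrence.

Lemma mean_ge_at (R : realType) (M : nat) (Q F : 'I_M -> R) p a :
    (forall a, 0 < Q a) -> 0 <= p <= Q a -> (forall a, 0 <= F a) ->
  p * F a <= mean Q F.
Proof.
move=> Q0 /andP[p0 pQ] F0; rewrite /mean (bigD1 a) //= -[leLHS]addr0 lerD //.
  by rewrite ler_wpM2r.
by apply: sumr_ge0 => i _; rewrite mulr_ge0 // ltW.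
Qed.

(** * Policies as Markov operators and the Bellman equation *)

Section Policies.
Variables (R : realType) (N M : nat) (Q P : 'I_M -> R).
Hypotheses (lawQ : full_support_law Q) (lawP : full_support_law P).

Local Notation state := (config N.+1 M).
Implicit Types (s : state) (u y : 'I_M) (rho : policy N.+1 M) (f : 'I_N.+1 -> 'I_M).

Definition sorted_config f : state :=
  exist _ [tuple of sort (@loc_le M) [tuple f i | i < N.+1]]
    (sort_sorted (@loc_le_total M) _).

Lemma stepE s k y : step s k y = sorted_config (upd (driver s) k y).
Proof. by apply/val_inj/val_inj. Qed.

Lemma sorted_config_perm f (pi : {perm 'I_N.+1}) :
  sorted_config (f \o pi) = sorted_config f.
Proof.
apply/val_inj/val_inj => /=; apply/perm_sortP.
- exact: loc_le_total.
- by move=> a b c; exact: leq_trans.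
- by move=> a b /anti_leq /val_inj.
apply/(@tuple_permP _ N.+1 _ [tuple f i | i < N.+1]); exists pi.
have E : [tuple (f \o pi) i | i < N.+1] = [tuple tnth [tuple f i | i < N.+1] (pi i) | i < N.+1].
  by apply: eq_from_tnth => i; rewrite !tnth_mktuple.
exact: (congr1 (@tval _ 'I_M) E).
Qed.

Lemma driver_sorted_config f :
  exists pi : {perm 'I_N.+1}, driver (sorted_config f) = f \o pi.
Proof.
have : perm_eq (sort (@loc_le M) [tuple f i | i < N.+1]) [tuple f i | i < N.+1].
  by rewrite perm_sort.
move=> /(@tuple_permP _ N.+1 _ [tuple f i | i < N.+1])[pi piE]; exists pi; apply/funext => i.
rewrite /driver (tnth_nth (f i)) /= piE -tnth_nth tnth_mktuple.
by rewrite tnth_mktuple.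
Qed.

Lemma sorted_driver s : sorted_config (driver s) = s.
Proof.
have : [tuple driver s i | i < N.+1] = val s.
  by apply: eq_from_tnth => i; rewrite tnth_mktuple.
move=> /(congr1 (@tval _ 'I_M)) E; apply/val_inj/val_inj; rewrite /= in E *; rewrite E.
by apply/sorted_sort; [move=> a b c; exact: leq_trans | exact: (valP s)].
Qed.

(** Exact matching determines only the place of the chosen driver; after sorting, its index does not
    matter. *)
Lemma sorted_config_upd f i l y : f l = f i ->
  sorted_config (upd f l y) = sorted_config (upd f i y).
Proof.
have [->//|il fli] := eqVneq i l.
rewrite (upd_tperm f y il) sorted_config_perm -fli; congr sorted_config.
by apply/funext => j; rewrite /upd; case: (eqVneq j l) => // ->; rewrite eq_sym (negPf il).
Qed.

Definition policy_operator rho (v : state -> R) s : R :=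
  mean Q (fun u => mean P (fun y => v (step s (rho s u) y))).

Definition policy_cost rho s : R :=
  mean Q (fun u => dist R u (driver s (rho s u))).

Lemma policy_operator_markov rho : markov_operator (policy_operator rho).
Proof.
have [Q0 Q1] := lawQ; have [P0 P1] := lawP; split.
- move=> a v w; apply/funext => s; rewrite /policy_operator -meanZ -meanD.
  by congr mean; apply/funext => u; rewrite -meanZ -meanD.
- by move=> v w vw s; apply: ler_mean => // u; exact: ler_mean.
- move=> a; apply/funext => s; rewrite /policy_operator.
  by rewrite -[RHS](mean_cst Q1 a); congr mean; apply/funext => u; rewrite mean_cst.
Qed.

Section Discounted.
Variable b : R.
Hypotheses (b_ge0 : 0 <= b) (b_le1 : b <= 1).

Let V n s := value Q P b n (driver s).

Lemma value_step n s k y : V n (step s k y) = value Q P b n (upd (driver s) k y).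
Proof.
rewrite stepE /V; have [pi ->] := driver_sorted_config (upd (driver s) k y).
exact: value_perm.
Qed.

(** The loss of one decision of [rho] against the best one, with [n] discounted stages to follow. *)
Definition policy_gap rho n s u : R :=
  action_value Q P b n (driver s) u (rho s u)
    - minval (action_value Q P b n (driver s) u).

Lemma policy_gap_ge0 rho n s u : 0 <= policy_gap rho n s u.
Proof. by rewrite subr_ge0 minval_le. Qed.

Lemma bellman rho n s :
  policy_cost rho s + b * policy_operator rho (V n) s =
  V n.+1 s + mean Q (policy_gap rho n s).
Proof.
rewrite /V valueS -meanD /policy_cost -meanZ -meanD; congr mean; apply/funext => u.
rewrite /policy_gap [RHS]addrC subrK /action_value; congr (_ + _ * mean P _).
by apply/funext => y; exact: value_step.
Qed.

Definition greedy_policy n : policy N.+1 M :=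
  fun s u => argmin (action_value Q P b n (driver s) u).

Lemma bellman_greedy n s :
  policy_cost (greedy_policy n) s + b * policy_operator (greedy_policy n) (V n) s =
  V n.+1 s.
Proof.
rewrite bellman [mean _ _]big1 ?addr0 // => u _.
by rewrite /policy_gap subrr mulr0.
Qed.

End Discounted.

Variable p : R.
Hypotheses (p_gt0 : 0 < p) (pQ : forall a, p <= Q a) (pP : forall a, p <= P a).

Lemma policy_operator_ge rho (v : state -> R) s u y : (forall s, 0 <= v s) ->
  p * (p * v (step s (rho s u) y)) <= policy_operator rho v s.
Proof.
have p0 := ltW p_gt0; have [Q0 _] := lawQ; have [P0 _] := lawP => v0.
have F0 u' : 0 <= mean P (fun y => v (step s (rho s u') y)).
  by apply: sumr_ge0 => y' _; rewrite mulr_ge0 // ltW.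
have pQu : 0 <= p <= Q u by rewrite p0 pQ.
apply: le_trans (mean_ge_at Q0 pQu F0); rewrite ler_wpM2l //.
have pPy : 0 <= p <= P y by rewrite p0 pP.
exact: (mean_ge_at P0 pPy).
Qed.

(* Until B is met, exact matchings bring the drivers one by one to the places
   of those of t. *)
Lemma visits_ge rho (B : pred state) t : B t ->
    (forall s k u, ~~ B s -> driver s k = u -> driver s (rho s u) = u) ->
  forall s, (p ^+ 2) ^+ N.+1 <= visits (policy_operator rho) B N.+2 s.
Proof.
move=> Bt matched s; have A_markov := policy_operator_markov rho.
have p0 := ltW p_gt0; have p1 : p <= 1 by exact: (p_le1 lawQ pQ (driver t ord0)).
have pk1 k : (p ^+ 2) ^+ k <= 1.
  by rewrite -exprM exprn_ile1.
have inB k s' : B s' -> (p ^+ 2) ^+ k <= visits (policy_operator rho) B k.+1 s'.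
  move=> Bs; rewrite visitsS // Bs; apply: le_trans (pk1 k) _; rewrite lerDl.
  rewrite -[leLHS](markov_cst A_markov 0 s'); apply: markov_le => // r.
  exact: visits_ge0.
(* Induction on the number of labels at which [f] disagrees with [t]; one extra stage counts the
   visit itself. *)
suff H k f : (#|[pred i | f i != driver t i]| <= k)%N ->
    (p ^+ 2) ^+ k <= visits (policy_operator rho) B k.+1 (sorted_config f).
  by rewrite -(sorted_driver s); apply: H; rewrite -[leqRHS](card_ord N.+1) max_card.
elim: k f => [|k IH] f card_le.
  apply: inB; have -> : f = driver t; last by rewrite sorted_driver.
  apply/funext => i; apply/eqP; move: card_le; rewrite leqNgt; apply: contraR => fi.
  by apply/card_gt0P; exists i; rewrite inE.
have [/inB//|nB] := boolP (B (sorted_config f)).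
have [i fi|all_eq] := pickP [pred i | f i != driver t i]; last first.
  move: nB; have -> : f = driver t; last by rewrite sorted_driver Bt.
  by apply/funext => i; have /negbFE/eqP := all_eq i.
have [pi dE] := driver_sorted_config f.
have di : driver (sorted_config f) (pi^-1%g i) = f i by rewrite dE /= permKV.
have {}di := matched _ _ _ nB di.
rewrite visitsS // exprS -[leLHS]add0r lerD ?ler0n //.
set u := f i in di *.
(* Keep only the event that the user arrives at [f i] and the new driver at [driver t i]: one
   disagreement disappears. *)
apply: le_trans (policy_operator_ge rho _ u (driver t i) _); last first.
  by move=> r; exact: visits_ge0.
rewrite expr2 -mulrA ler_wpM2l // ler_wpM2l //.
have -> : step (sorted_config f) (rho (sorted_config f) u) (driver t i) =
   sorted_config (upd f i (driver t i)).
  rewrite stepE {1}dE upd_perm sorted_config_perm; apply: sorted_config_upd.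
  by move: di; rewrite {1}dE.
apply: IH; rewrite -ltnS; apply: leq_trans card_le.
rewrite [X in (_ < X)%N](cardD1 i) inE (fi : f i != driver t i) add1n ltnS.
apply/subset_leq_card/fintype.subsetP => j; rewrite !inE /upd.
by case: (eqVneq j i) => [->|_] //; rewrite eqxx.
Qed.

Local Open Scope classical_set_scope.

(** Optimality expressed through the transition operators, free of the probability space; the limits
    exist by [time_average_cvg]. *)
Definition average_optimal rho : Prop :=
  forall rho' s a a',
    time_average (policy_operator rho) (policy_cost rho) s @ \oo --> a ->
    time_average (policy_operator rho') (policy_cost rho') s @ \oo --> a' -> a <= a'.

(* As the discount tends to 1, discounted values, which have span at most N,
   almost solve the average cost optimality equation; rho pays eta extra at
   each visit of B, and these visits have positive frequency. *)
Lemma no_uniform_gap rho (B : pred state) t eta : average_optimal rho ->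
    B t -> 0 < eta ->
    (forall s k u, ~~ B s -> driver s k = u -> driver s (rho s u) = u) ->
    (forall b, 2^-1 <= b -> b <= 1 -> forall n, (N < n)%N -> forall s, B s ->
       eta <= mean Q (policy_gap b rho n s)) ->
  False.
Proof.
move=> opt Bt eta0 matched gapB.
have A_markov r := policy_operator_markov r.
have [psi psiE] := visits_potential (A_markov rho) (ltn0Sn N.+1) (visits_ge Bt matched).
move: psiE; set q := _ / _ => psiE.
have q0 : 0 < q by rewrite divr_gt0 // exprn_gt0 // exprn_gt0.
pose e := eta * q; have e0 : 0 < e by exact: mulr_gt0.
pose K : R := N.+1%:R; have K0 : 0 < K by rewrite ltr0n.
(* [dl] is 1 - b. The lower bound below exceeds the upper one by [e - b ^+ n - 2 * dl * K], which is
   positive once [dl * K <= e / 8] and [b ^+ n < e / 4]. *)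
pose dl := Num.min 2^-1 (e / (8 * K)).
have dl0 : 0 < dl by rewrite lt_min invr_gt0 ltr0n /= divr_gt0 // mulr_gt0.
have dl2 : dl <= 2^-1 by rewrite ge_min lexx.
have dlK : dl * K <= e / 8.
  have : dl <= e / (8 * K) by rewrite ge_min lexx orbT.
  rewrite -(ler_pM2r K0) => /le_trans; apply.
  by rewrite invfM !mulrA mulfVK // gt_eqF.
pose b := 1 - dl.
have b_half : 2^-1 <= b by rewrite /b; lra.
have b0 : 0 <= b by apply: le_trans b_half; rewrite invr_ge0.
have b_lt1 : b < 1 by rewrite /b; lra.
have b1 := ltW b_lt1.
have [n Nn bn] : exists2 n, (N < n)%N & b ^+ n < e / 4.
  have /cvgr_lt /(_ (e / 4)) : (fun n => b ^+ n) @ \oo --> (0 : R).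
    by apply: cvg_expr; rewrite ger0_norm.
  case=> [|n0 _ h]; first by rewrite divr_gt0.
  by exists (maxn n0 N.+1); [exact: leq_maxr | apply: h => /=; exact: leq_maxl].
pose V s := value Q P b n (driver s).
have spanV s : V s - V t <= K /\ V t - V s <= K.
  by split; rewrite lerBlDl; apply: value_span.
have [a aE] := time_average_cvg (A_markov rho) (policy_cost rho).
pose sg := greedy_policy b n.
have [a' a'E] := time_average_cvg (A_markov sg) (policy_cost sg).
have := opt sg t _ _ (aE t) (a'E t).
have Aspan r s : policy_operator r V s <= V t + K /\ V t - K <= policy_operator r V s.
  split.
    rewrite -[leRHS](markov_cst (A_markov r) _ s); apply: markov_le => // s'.
    by have [] := spanV s'; lra.
  rewrite -[leLHS](markov_cst (A_markov r) _ s); apply: markov_le => // s'.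
  by have [] := spanV s'; lra.
(* The gap on [B] is spread by [psi] into a constant surplus [eta * q] at every state; replacing the
   discount by 1 costs an error controlled by the span. *)
have lower : dl * V t + e - dl * K <= a t.
  apply: (@time_average_ge _ _ _ (A_markov rho) _ _ _ _ (fun s => eta * psi s + V s) (aE t)) => s.
  have -> : policy_operator rho (fun s => eta * psi s + V s) s =
      eta * policy_operator rho psi s + policy_operator rho V s.
    by case: (A_markov rho) => ->.
  have := bellman b rho n s; rewrite -/V.
  have /andP[] := value_incr lawQ lawP b0 n (driver s); rewrite -/(V s).
  have : eta * (B s)%:R <= mean Q (policy_gap b rho n s).
    case: (boolP (B s)) => [Bs|_]; first by rewrite mulr1 gapB.
    rewrite mulr0; apply: sumr_ge0 => u _.
    by rewrite mulr_ge0 ?policy_gap_ge0 // ltW //; case: lawQ.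
  have : eta * (psi s + q) <= eta * (policy_operator rho psi s + (B s)%:R).
    by rewrite ler_pM2l.
  have : dl * (V t - K) <= dl * policy_operator rho V s.
    by rewrite ler_pM2l //; case: (Aspan rho s).
  rewrite /b /e.
  move: (policy_operator _ V s) (policy_operator _ psi s) => X Y.
  lra.
(* The policy greedy for [V] attains the Bellman minimum, so only [b ^+ n] and the span error
   remain. *)
have upper : a' t <= dl * V t + b ^+ n + dl * K.
  apply: (@time_average_le _ _ _ (A_markov sg) _ _ _ _ V (a'E t)) => s.
  have := bellman_greedy b n s; rewrite -/V -/sg.
  have /andP[_] := value_incr lawQ lawP b0 n (driver s); rewrite -/(V s).
  have : dl * policy_operator sg V s <= dl * (V t + K).
    by rewrite ler_pM2l //; case: (Aspan sg s).
  move: (b ^+ n) (value _ _ _ n.+1 _) => z W.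
  rewrite /b; move: (policy_operator _ V s) => X.
  lra.
lra.
Qed.

End Policies.

(** * Choices of an optimal policy *)
Lemma law_lower_bound (R : realType) (M : nat) (Q P : 'I_M -> R) :
    full_support_law Q -> full_support_law P ->
  exists2 p : R, 0 < p & (forall a, p <= Q a) /\ (forall a, p <= P a).
Proof.
move=> [Q0 _] [P0 _]; exists (\big[Num.min/1]_a Num.min (Q a) (P a)).
  by apply: lt_bigmin => // a _; rewrite lt_min Q0 P0.
by split=> a; (apply: le_trans; first exact: (bigmin_le_cond _ _ (j := a)));
  rewrite ge_min lexx ?orbT.
Qed.

Section OptimalPolicies.
Variables (R : realType) (N M : nat) (Q P : 'I_M -> R).
Hypotheses (lawQ : full_support_law Q) (lawP : full_support_law P).
Implicit Types (s : config N.+1 M) (u : 'I_M).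

Lemma neighbour_exact s k u :
  driver s k = u -> right_neighbour u s = u /\ left_neighbour u s = u.
Proof.
move=> <-; have ds : driver s k \in val s by exact: mem_tnth.
split.
  apply: first_right_inj (right_neighbourP _ s) _; split=> // c _.
  by rewrite arc_lengthxx.
apply: first_left_inj (left_neighbourP _ s) _; split=> // c _.
by rewrite arc_lengthxx.
Qed.

Lemma neighbour_driver s u :
  (exists k, driver s k = right_neighbour u s) /\
  (exists k, driver s k = left_neighbour u s).
Proof.
have [/tnthP[k ->] _] := right_neighbourP u s.
by have [/tnthP[k' ->] _] := left_neighbourP u s; split; [exists k | exists k'].
Qed.

Variable rho : policy N.+1 M.
Hypothesis rho_opt : average_optimal Q P rho.

Let neighbour s u :=
  (driver s (rho s u) == right_neighbour u s) || (driver s (rho s u) == left_neighbour u s).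

Let exact_of_neighbour s k u : neighbour s u -> driver s k = u -> driver s (rho s u) = u.
Proof.
by move=> nb /neighbour_exact[rE lE]; move: nb; rewrite /neighbour rE lE => /orP[] /eqP.
Qed.

Lemma optimal_neighbour s u :
  driver s (rho s u) = right_neighbour u s \/ driver s (rho s u) = left_neighbour u s.
Proof.
suff /orP[/eqP|/eqP] : neighbour s u by [left | right].
apply/negPn/negP => bad.
have [p p0 [pQ pP]] := law_lower_bound lawQ lawP.
have [Q0 _] := lawQ.
(* Outside [B] every choice is a neighbour, so exact matching holds there, as [no_uniform_gap]
   demands. *)
pose B s' := [exists u', ~~ neighbour s' u'].
have Bs : B s by apply/existsP; exists u.
apply: (no_uniform_gap lawQ lawP p0 pQ pP rho_opt Bs (eta := p * (2^-1 * swap_gain M p N))).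
- apply: mulr_gt0 => //; apply: mulr_gt0; first by rewrite invr_gt0.
  exact: (swap_gain_gt0 p0 u).
- move=> s' k u'; rewrite negb_exists => /forallP/(_ u')/negPn; exact: exact_of_neighbour.
move=> b bh b1 n Nn s' /existsP[u' bad'].
have b0 : 0 <= b by apply: le_trans bh; rewrite invr_ge0.
have pQu : 0 <= p <= Q u' by rewrite ltW //= pQ.
have gap0 := policy_gap_ge0 Q P b rho n s'.
apply: le_trans (mean_ge_at Q0 pQu gap0); rewrite ler_wpM2l ?(ltW p0) //.
set i := rho s' u'.
have [k [dk near]] : exists k, driver s' k != driver s' i /\
   (ndist u' (driver s' k) + ndist (driver s' k) (driver s' i) <= ndist u' (driver s' i))%N.
  have ds : driver s' i \in val s' by exact: mem_tnth.
  move: bad'; rewrite negb_or => /andP[br bl].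
  have [[k kE] [l lE]] := neighbour_driver s' u'.
  have [h|h] := neighbour_on_geodesic (right_neighbourP u' s') (left_neighbourP u' s') ds.
    by exists k; rewrite kE eq_sym.
  by exists l; rewrite lE eq_sym.
rewrite /policy_gap lerBrDl.
apply: (action_value_between lawQ lawP b0 b1 p0 pQ pP bh Nn dk).
by rewrite !distE -mulrDl -natrD ler_pM2r ?invr_gt0 ?(size_circle_gt0 R u') // ler_nat.
Qed.

Let exact_match s k u : driver s k = u -> driver s (rho s u) = u.
Proof.
apply: exact_of_neighbour; apply/orP.
by have [->|->] := optimal_neighbour s u; [left | right].
Qed.

(* Exchanging the choices of rho at u and u' changes neither of the resulting
   configurations, so it must not decrease the total distance. *)
Lemma optimal_exchange s u u' :
  dist R u (driver s (rho s u)) + dist R u' (driver s (rho s u')) <=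
  dist R u (driver s (rho s u')) + dist R u' (driver s (rho s u)).
Proof.
set a := driver s (rho s u); set c := driver s (rho s u').
rewrite leNgt; apply/negP => lt.
have [p p0 [pQ pP]] := law_lower_bound lawQ lawP.
have [Q0 _] := lawQ.
pose e := dist R u a + dist R u' c - (dist R u c + dist R u' a).
have e0 : 0 < e by rewrite subr_gt0.
(* Exact matching is now known everywhere, so the single configuration [s] can serve as the bad
   set. *)
apply: (no_uniform_gap lawQ lawP p0 pQ pP rho_opt (B := pred1 s) (eqxx s) (eta := p * (e / 2))).
- by rewrite mulr_gt0 // divr_gt0.
- by move=> s' k u'' _; exact: exact_match.
move=> b _ _ n _ s' /eqP->.
have gap0 := policy_gap_ge0 Q P b rho n s.
suff [u'' h] : exists u'', e / 2 <= policy_gap Q P b rho n s u''.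
  have pQu : 0 <= p <= Q u'' by rewrite ltW //= pQ.
  by apply: le_trans (mean_ge_at Q0 pQu gap0); rewrite ler_wpM2l // ltW.
(* The continuation values cancel in the sum of the two gaps, so one gap is at least [e / 2]. *)
have : e <= policy_gap Q P b rho n s u + policy_gap Q P b rho n s u'.
  rewrite /policy_gap.
  have := minval_le (action_value Q P b n (driver s) u) (rho s u').
  have := minval_le (action_value Q P b n (driver s) u') (rho s u).
  rewrite /e /action_value -/a -/c; lra.
have [h _|h] := leP (e / 2) (policy_gap Q P b rho n s u); first by exists u.
by exists u'; lra.
Qed.

Let reflected s u := reflect_ord (left_neighbour u s) (right_neighbour u s) u.

Let reflected_neighbours s u :
  left_neighbour (reflected s u) s = left_neighbour u s /\
  right_neighbour (reflected s u) s = right_neighbour u s.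
Proof.
have [fl fr] := first_reflect (left_neighbourP u s) (right_neighbourP u s).
split; first exact: first_left_inj (left_neighbourP _ _) fl.
exact: first_right_inj (right_neighbourP _ _) fr.
Qed.

(** Some neighbour is at least as near as any given driver; so if the choice, itself a neighbour, is
    not nearest, the other neighbour is strictly nearer. *)
Let not_greedy_farther s u : ~~ greedy_at R rho s u ->
  let l := left_neighbour u s in let r := right_neighbour u s in
  (driver s (rho s u) = l /\ dist R u r < dist R u l) \/
  (driver s (rho s u) = r /\ dist R u l < dist R u r).
Proof.
rewrite negb_forall => /existsP[k]; rewrite -ltNge => lt l r.
have ds : driver s k \in val s by exact: mem_tnth.
have : dist R u r <= dist R u (driver s k) \/ dist R u l <= dist R u (driver s k).
  rewrite !ler_dist.
  have [h|h] := neighbour_on_geodesic (right_neighbourP u s) (left_neighbourP u s) ds.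
    by left; apply: leq_trans h; exact: leq_addr.
  by right; apply: leq_trans h; exact: leq_addr.
move: lt; have [->|->] := optimal_neighbour s u; rewrite -/l -/r => lt [h|h].
- by have := le_lt_trans h lt; rewrite ltxx.
- by right; split=> //; exact: le_lt_trans lt.
- by left; split=> //; exact: le_lt_trans lt.
- by have := le_lt_trans h lt; rewrite ltxx.
Qed.

(** Reflection exchanges the distances to the two neighbours. Two non-greedy choices would take the
    farther neighbour at each point, hence opposite ones, and exchanging them would lower the total
    distance. *)
Lemma greedy_reflected s u : ~~ greedy_at R rho s u -> greedy_at R rho s (reflected s u).
Proof.
move=> ng; apply/negPn/negP => ng'.
have [lE rE] := reflected_neighbours s u.
have [dl dr] := ndist_reflect (left_neighbour u s) (right_neighbour u s) u.
have := not_greedy_farther ng'; rewrite lE rE.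
have {dl}dl : dist R (reflected s u) (left_neighbour u s) = dist R u (right_neighbour u s).
  by rewrite !distE dl.
have {dr}dr : dist R (reflected s u) (right_neighbour u s) = dist R u (left_neighbour u s).
  by rewrite !distE dr.
have := optimal_exchange s u (reflected s u).
rewrite /= dl dr.
have [[-> h]|[-> h]] := not_greedy_farther ng => H;
  by move=> [[]|[]]; move: H => /[swap] ->; rewrite ?dl ?dr; lra.
Qed.

Lemma half_greedy :
  (#|{: config N.+1 M * 'I_M}| <=
     2 * #|[pred su : config N.+1 M * 'I_M | greedy_at R rho su.1 su.2]|)%N.
Proof.
set G := [pred su | _].
rewrite -(cardC G) mul2n -addnn leq_add2l.
pose f (su : config N.+1 M * 'I_M) := (su.1, reflected su.1 su.2).
(* The reflection keeps both neighbours, so states with the same image are reflected in the same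
   gap, by the same involution. *)
have f_inj : injective f.
  move=> [s u] [s' u'] fE; have ss : s = s' := congr1 fst fE.
  have e : reflected s u = reflected s' u' := congr1 snd fE.
  rewrite -{s'}ss in fE e *.
  have := reflected_neighbours s u; have := reflected_neighbours s u'.
  rewrite e => -[-> ->] [lE rE]; move: e; rewrite /reflected lE rE.
  by move=> /(can_inj (reflect_ordK _ _)) ->.
rewrite -(fintype.card_image f_inj (predC G)).
apply/subset_leq_card/fintype.subsetP => _ /fintype.imageP[[s u] ng ->].
by rewrite inE; apply: greedy_reflected.
Qed.

End OptimalPolicies.

(** * Expected costs *)
(** The values of [A] at indicators are transition probabilities; this expansion links the operator
    with events. *)
Lemma markov_expand (R : realType) (S : finType) (A : (S -> R) -> S -> R) v s :
  markov_operator A -> A v s = \sum_r v r * A (fun s => (s == r)%:R) s.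
Proof.
move=> A_markov.
have {1}-> : v = fun s => \sum_r v r * (s == r)%:R.
  apply/funext => r; rewrite (bigD1 r) //= eqxx mulr1 big1 ?addr0 // => q qr.
  by rewrite eq_sym (negPf qr) mulr0.
rewrite (markov_sum A_markov _ (fun r s => v r * (s == r)%:R)).
by apply: eq_bigr => r _; rewrite markovZ.
Qed.

(** * Finitely valued random variables *)

Section FiniteVariables.
Variables (d : measure_display) (Omega : measurableType d) (R : realType).
Variable Pr : probability Omega R.
Local Open Scope classical_set_scope.

Definition measurable_fibres (I : Type) (z : Omega -> I) : Prop :=
  forall i, measurable (z @^-1` [set i]).

Lemma measurable_fibres_comp (I J : finType) (f : I -> J) z :
  measurable_fibres z -> measurable_fibres (f \o z).
Proof.
move=> mz j.
have -> : (f \o z) @^-1` [set j] = \bigcup_(i in [set i | f i = j]) z @^-1` [set i].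
  by apply/seteqP; split=> w /= => [<-|[i <- ->//]]; exists (z w).
by apply: fin_bigcup_measurable => // i _; exact: mz.
Qed.

Lemma measurable_fibres_pair (I J : finType) (z : Omega -> I) (z' : Omega -> J) :
  measurable_fibres z -> measurable_fibres z' ->
  measurable_fibres (fun w => (z w, z' w)).
Proof.
move=> mz mz' [i j].
have -> : (fun w => (z w, z' w)) @^-1` [set (i, j)] = z @^-1` [set i] `&` z' @^-1` [set j].
  by apply/seteqP; split=> w /= => [[-> ->]|[-> ->]].
exact: measurableI.
Qed.

Lemma probability_partition (I : finType) (z : Omega -> I) E :
  measurable_fibres z -> measurable E ->
  Pr E = (\sum_i Pr (E `&` z @^-1` [set i]))%E.
Proof.
move=> mz mE.
have {1}-> : E = \bigcup_(i in [set: I]) (E `&` z @^-1` [set i]).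
  by apply/seteqP; split=> w /= => [Ew|[i _ []//]]; exists (z w).
rewrite measure_fin_bigcup.
- rewrite -[RHS]big_enum /= [RHS]fsbig_seq ?enum_uniq //.
  by apply: eq_fsbigl => //; apply/seteqP; split=> i //= _; rewrite mem_enum.
- exact: finite_finset.
- by move=> i j _ _ [w [[_ <-] [_ <-]]].
- by move=> i _; apply: measurableI.
Qed.

Lemma expectation_finite (I : finType) (z : Omega -> I) (g : I -> R) :
    measurable_fibres z -> (forall i, 0 <= g i) ->
  ('E_Pr[(fun w => g (z w))] = \sum_i (g i)%:E * Pr (z @^-1` [set i]))%E.
Proof.
move=> mz g0; rewrite unlock.
transitivity (\int[Pr]_w (\sum_i (g i)%:E * (\1_(z @^-1` [set i]) w)%:E))%E.
  apply: eq_integral => w _.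
  rewrite (bigD1 (z w)) //= big1 => [|i zi].
    by rewrite indicE mem_set // mule1 adde0.
  by rewrite indicE memNset ?mule0 //= => e; rewrite e eqxx in zi.
rewrite ge0_integral_sum //.
- apply: eq_bigr => i _; rewrite ge0_integralZl_EFin //.
    by rewrite integral_indic // setIT.
  by apply/measurable_EFinP; exact: measurable_indic.
- by move=> i; apply: measurable_funeM; apply/measurable_EFinP; exact: measurable_indic.
- by move=> i w _; rewrite mule_ge0 // lee_fin.
Qed.

End FiniteVariables.

(** * Law of the state and expected stage costs *)

Section Simulation.
Variables (d : measure_display) (Omega : measurableType d) (R : realType).
Variables (Pr : probability Omega R) (N M : nat) (Q P : 'I_M -> R).
Hypotheses (lawQ : full_support_law Q) (lawP : full_support_law P).
Variables (x y : nat -> Omega -> 'I_M).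
Hypothesis xy_iid : arrivals Pr Q P x y.
Variables (rho : policy N.+1 M) (s0 : config N.+1 M).
Local Open Scope classical_set_scope.

Let arrival (i : nat + nat) : Omega -> 'I_M :=
  match i with inl t => x t | inr t => y t end.

Let arrival_law (i : nat + nat) : 'I_M -> R :=
  match i with inl t => Q | inr t => P end.

Let time (i : nat + nat) : nat := match i with inl t => t | inr t => t end.

Let A := policy_operator Q P rho.

Let state t w := drivers_at rho s0 (x^~ w) (y^~ w) t.

Let A_markov : markov_operator A := policy_operator_markov lawQ lawP rho.

Lemma arrival_has_law i : has_law Pr (arrival i) (arrival_law i).
Proof. by case: xy_iid => hx hy _; case: i. Qed.

Let next (v : config N.+1 M * 'I_M * 'I_M) : config N.+1 M :=
  step v.1.1 (rho v.1.1 v.1.2) v.2.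

Lemma measurable_state t : measurable_fibres (state t).
Proof.
elim: t => [|t IH].
  by move=> s; rewrite (_ : _ @^-1` _ = if s0 == s then setT else set0); [case: ifP |
    apply/seteqP; split=> w /=; case: eqP].
have mx : measurable_fibres (x t) by move=> a; case: (arrival_has_law (inl t) a).
have my : measurable_fibres (y t) by move=> a; case: (arrival_has_law (inr t) a).
exact: (measurable_fibres_comp next (measurable_fibres_pair (measurable_fibres_pair IH mx) my)).
Qed.

Let cylinder (J : seq (nat + nat)) (a : nat + nat -> 'I_M) : set Omega :=
  \bigcap_(i in [set` J]) arrival i @^-1` [set a i].

Lemma measurable_cylinder J a : measurable (cylinder J a).
Proof.
rewrite /cylinder bigcap_seq; apply: bigsetI_measurable => i _.
by case: (arrival_has_law i (a i)).
Qed.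

(** The state at [t] depends only on arrivals before [t], hence is independent of those in [J]. The
    list [J] is arbitrary so that the induction can adjoin both arrivals of stage [t]. *)
Lemma state_future_law t s J a : uniq J -> (forall i, i \in J -> (t <= time i)%N) ->
  Pr (state t @^-1` [set s] `&` cylinder J a) =
  (iter t A (fun r => (r == s)%:R) s0 * \prod_(i <- J) arrival_law i (a i))%:E.
Proof.
elim: t s J a => [|t IH] s J a Ju Jt /=.
  case: eqP => [<-|ne].
    rewrite (_ : _ @^-1` _ = setT); last by apply/seteqP; split.
    rewrite setTI mul1r; case: xy_iid => _ _ /(_ J (fun i => [set a i]) Ju) ->.
    rewrite -prodEFin; apply: eq_bigr => i _.
    by case: (arrival_has_law i (a i)).
  rewrite (_ : _ @^-1` _ = set0) ?set0I ?measure0 ?mul0r //.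
  by apply/seteqP; split=> w //= /ne.
have mx : measurable_fibres (x t) by move=> c; case: (arrival_has_law (inl t) c).
have my : measurable_fibres (y t) by move=> c; case: (arrival_has_law (inr t) c).
have mz := measurable_fibres_pair (measurable_fibres_pair (measurable_state t) mx) my.
rewrite (probability_partition Pr mz); last first.
  by apply: measurableI; [exact: (measurable_state t.+1) | exact: measurable_cylinder].
pose D := \prod_(i <- J) arrival_law i (a i).
transitivity (\sum_(v : config N.+1 M * 'I_M * 'I_M)
    (iter t A (fun r => (r == v.1.1)%:R) s0 * (Q v.1.2 * (P v.2 * ((next v == s)%:R * D))))%:E)%E.
  apply: eq_bigr => -[[r u] c] _ /=.
  have [nv|nv] := eqVneq (next (r, u, c)) s; last first.
    rewrite mul0r !mulr0 (_ : _ `&` _ = set0) ?measure0 //.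
    apply/seteqP; split=> // w /= [[es _]] [e1 e2 e3].
    by move: nv; rewrite /next /= -es /state /= -/(state t w) e1 e2 e3 eqxx.
  (* [a'] also prescribes the arrivals of stage [t]; they are not in [J], where all times exceed
     [t]. *)
  pose a' i := if i == inl t then u else if i == inr t then c else a i.
  have tJ i : i \in J -> (i == inl t = false) * (i == inr t = false).
    by move=> /Jt; case: i => i /= lt; split=> //; apply/negP => /eqP [ei]; rewrite ei ltnn in lt.
  pose J' := inl t :: inr t :: J.
  have J'u : uniq J'.
    rewrite /J' /= Ju inE /= andbT; apply/andP; split.
      by apply/negP => /tJ; rewrite eqxx => -[].
    by apply/negP => /tJ; rewrite eqxx => -[].
  have J't i : i \in J' -> (t <= time i)%N.
    by rewrite !inE => /orP[/eqP->|/orP[/eqP->|/Jt/ltnW]].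
  have DJ' : \prod_(i <- J') arrival_law i (a' i) = Q u * (P c * D).
    rewrite /J' !big_cons /a' !eqxx /=; congr (_ * (_ * _)).
    by apply: eq_big_seq => i iJ; rewrite !tJ.
  rewrite mul1r -DJ' -IH //; congr (Pr _).
  apply/seteqP; split=> w /=.
    move=> [[_ wJ] [-> xu yc]]; split=> // i; rewrite /J' /= !inE /a'.
    have [->//|_] := eqVneq i (inl t); have [->//|_] := eqVneq i (inr t).
    exact: wJ.
  move=> [wr wJ'].
  have wx : x t w = u by have := wJ' (inl t); rewrite /a' /= !inE !eqxx; apply.
  have wy : y t w = c by have := wJ' (inr t); rewrite /a' /= !inE eqxx orbT; apply.
  split; last by rewrite wr wx wy.
  split; first by rewrite -nv /next /state /= -/(state t w) wr wx wy.
  move=> i iJ; have := wJ' i; rewrite /J' /a' /= !inE !tJ //=; exact.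
rewrite sumEFin; congr EFin.
(* With [A] applied first to the indicator of [s], the expansion runs over the state [r] at stage
   [t]. *)
rewrite -iterS iterSr (markov_expand _ _ (iter_markov A_markov t)) mulr_suml.
rewrite -(pair_bigA _ (fun ru c =>
  iter t A (fun r => (r == ru.1)%:R) s0 * (Q ru.2 * (P c * ((next (ru, c) == s)%:R * D))))) /=.
rewrite -(pair_bigA _ (fun r u => \sum_c
  iter t A (fun q => (q == r)%:R) s0 * (Q u * (P c * ((next (r, u, c) == s)%:R * D))))) /=.
apply: eq_bigr => r _; rewrite [X in X * _]mulrC -mulrA.
rewrite /A /policy_operator /mean mulr_suml mulr_sumr.
apply: eq_bigr => u _; rewrite -mulrA mulr_suml !mulr_sumr; apply: eq_bigr => c _.
by rewrite !mulrA.
Qed.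

(** The user of stage [t] is independent of the state met: [state_future_law] with [J] reduced to
    that arrival. *)
Lemma expected_stage_cost t :
  ('E_Pr[(fun w => stage_cost R rho s0 (x^~ w) (y^~ w) t)] =
   (iter t A (policy_cost Q rho) s0)%:E)%E.
Proof.
have mx : measurable_fibres (x t) by move=> c; case: (arrival_has_law (inl t) c).
have mz := measurable_fibres_pair (measurable_state t) mx.
pose g (v : config N.+1 M * 'I_M) := dist R v.2 (driver v.1 (rho v.1 v.2)).
rewrite (_ : (fun w => _) = fun w => g (state t w, x t w)) //.
rewrite (expectation_finite Pr mz); last by move=> v; exact: dist_ge0.
rewrite (markov_expand _ _ (iter_markov A_markov t)) -sumEFin.
rewrite (eq_bigr (fun v => (g v * (iter t A (fun q => (q == v.1)%:R) s0 * Q v.2))%:E)); last first.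
  move=> [r u] _ /=; rewrite EFinM; congr (_ * _)%E.
  have := @state_future_law t r [:: inl t] (fun=> u) isT.
  rewrite big_seq1 /= => <-; last by move=> i; rewrite inE => /eqP->.
  congr (Pr _); apply/seteqP; split=> w /=.
    by move=> [-> xu]; split=> // i; rewrite /= inE => /eqP->.
  by move=> [wr /(_ (inl t))]; rewrite /= inE eqxx => -> //; rewrite wr.
rewrite !sumEFin; congr EFin.
rewrite -(pair_bigA _ (fun r u => g (r, u) * (iter t A (fun q => (q == r)%:R) s0 * Q u))) /=.
apply: eq_bigr => r _; rewrite /policy_cost /mean mulr_suml; apply: eq_bigr => u _.
by rewrite /g /= mulrA mulrC mulrA.
Qed.

Lemma average_costE a : time_average A (policy_cost Q rho) s0 @ \oo --> a ->
  average_cost Pr x y rho s0 = a%:E.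
Proof.
move=> ca; rewrite /average_cost.
rewrite (_ : (fun T : nat => _) = EFin \o time_average A (policy_cost Q rho) s0).
  apply/cvg_lim => //; apply: cvg_EFin; first exact: nearW.
  exact: ca.
apply/funext => T /=; rewrite /time_average EFinM -sumEFin; congr (_ * _)%E.
by apply: eq_bigr => t _; exact: expected_stage_cost.
Qed.

End Simulation.

Theorem theorem4 (d : measure_display) (Omega : measurableType d)
    (R : realType) (Pr : probability Omega R)
    (N M : nat) (N_ge1 : (1 <= N)%N) (M_ge1 : (1 <= M)%N)
    (Q P : 'I_M -> R) (lawQ : full_support_law Q) (lawP : full_support_law P)
    (x y : nat -> Omega -> 'I_M) (xy_iid : arrivals Pr Q P x y)
    (rho : policy N M) (rho_opt : optimal Pr x y rho) :
  (forall (s : config N M) (u : 'I_M),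
     driver s (rho s u) = right_neighbour u s \/
     driver s (rho s u) = left_neighbour u s) /\
  (#|{: config N M * 'I_M}| <=
     2 * #|[pred su : config N M * 'I_M | greedy_at R rho su.1 su.2]|)%N.
Proof.
case: N N_ge1 rho rho_opt => [//|n] _ rho rho_opt.
have opt : average_optimal Q P rho.
  move=> rho' s a a' ca ca'; have := rho_opt rho' s.
  by rewrite (average_costE lawQ lawP xy_iid ca) (average_costE lawQ lawP xy_iid ca') lee_fin.
by split=> [s u|]; [exact: (optimal_neighbour lawQ lawP) | exact: (half_greedy lawQ lawP opt)].
Qed.
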